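(* Let $G$ be a perfect matching on $n=2k$ vertices labelled $u_iw_j$ with $i\in\{1,\dots,k\}$ and $j\in\{1,2\}$. Then $\rho(G)$ is separable in $\mathbb{C}^k_A\otimes\mathbb{C}^2_B$ if and only if $\Delta(G)=\Delta(G^{\Gamma_B})$.
   Context: A perfect matching is a simple graph $G=(V,E)$ in which every vertex $v$ belongs to exactly one edge. For a simple graph: $M(G)$ is the adjacency matrix, $\Delta(G)$ the diagonal degree matrix, $L(G)=\Delta(G)-M(G)$, $\rho(G)=\frac{1}{2|E|}L(G)$. Vertex $u_iw_j$ is identified with $|u_i\rangle\otimes|w_j\rangle$ for orthonormal bases $\{|u_i\rangle\}$ of $\mathbb{C}^k_A$ and $\{|w_j\rangle\}$ of $\mathbb{C}^2_B$. The partial transpose $G^{\Gamma_B}=(V,E')$ has $\{u_iw_j,u_{i'}w_{j'}\}\in E'$ iff $\{u_iw_{j'},u_{i'}w_j\}\in E$. Separable means a convex combination of product states. *)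

(* Defs.v *)
From mathcomp Require Import all_boot all_order all_algebra.
From mathcomp Require Import complex mxtens.
From mathcomp Require Import reals.

Set Implicit Arguments.
Unset Strict Implicit.
Unset Printing Implicit Defensive.

Import Order.TTheory GRing.Theory Num.Theory.
Local Open Scope ring_scope.

(* Vertices u_i w_j, i < k, j < 2; vertex (i, j) is identified with the basis
   vector |u_i> (x) |w_j>, i.e. with the index mxtens_index (i, j) of
   C^k (x) C^2 = C^(k*2) (the same index convention as tensmx). *)
Definition vert (k : nat) := ('I_k * 'I_2)%type.

Definition simple_graph (k : nat) (e : rel (vert k)) : Prop :=
  symmetric e /\ irreflexive e.

Definition deg (k : nat) (e : rel (vert k)) (v : vert k) : nat :=
  #|[set w | e v w]|.

Definition perfect_matching (k : nat) (e : rel (vert k)) : Prop :=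
  simple_graph e /\ forall v, deg e v = 1%N.

Definition twice_nedges (k : nat) (e : rel (vert k)) : nat :=
  #|[set p : vert k * vert k | e p.1 p.2]|.

Definition ptransB (k : nat) (e : rel (vert k)) : rel (vert k) :=
  fun x y => e (x.1, y.2) (y.1, x.2).

Section Matrices.
Variable C : numClosedFieldType.

Definition degmx (k : nat) (e : rel (vert k)) : 'M[C]_(k * 2) :=
  \matrix_(a, b) (if a == b then (deg e (mxtens_unindex a))%:R else 0).

Definition adjmx (k : nat) (e : rel (vert k)) : 'M[C]_(k * 2) :=
  \matrix_(a, b) (e (mxtens_unindex a) (mxtens_unindex b))%:R.

Definition lapmx (k : nat) (e : rel (vert k)) : 'M[C]_(k * 2) :=
  degmx e - adjmx e.

Definition rho (k : nat) (e : rel (vert k)) : 'M[C]_(k * 2) :=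
  ((twice_nedges e)%:R)^-1 *: lapmx e.

Definition adjoint (m n : nat) (A : 'M[C]_(m, n)) : 'M[C]_(n, m) :=
  (map_mx Num.conj A)^T.

Definition hermitian (n : nat) (A : 'M[C]_n) : Prop := adjoint A = A.

Definition psd (n : nat) (A : 'M[C]_n) : Prop :=
  hermitian A /\ forall v : 'cV[C]_n, 0 <= (adjoint v *m A *m v) 0 0.

Definition density (n : nat) (A : 'M[C]_n) : Prop := psd A /\ \tr A = 1.

Definition separable (m n : nat) (X : 'M[C]_(m * n)) : Prop :=
  exists (N : nat) (p : 'I_N -> C) (A : 'I_N -> 'M[C]_m) (B : 'I_N -> 'M[C]_n),
    [/\ forall l, 0 <= p l, \sum_l p l = 1,
        forall l, density (A l), forall l, density (B l) &
        X = \sum_l p l *: tensmx (A l) (B l)].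

End Matrices.

(* Main.v *)
(* Only if: a separable matrix has positive semidefinite partial transpose
   (Peres). The partial transpose of L(G) is N = Delta(G) - M(G^Gamma), and with
   g(c) = 1 - deg_{G^Gamma}(c) one has 1^T N 1 = 0, N 1 = g and N_cc = 1, so the
   quadratic form of N at 1 - g(c) e_c is - g(c)^2, which forces g = 0.

   If (writing A' for the adjoint of A): edges within a column j contribute the
   product states (e_i - e_l)(e_i - e_l)' (x) e_j e_j'. The edges between the
   two columns are encoded by the 0/1 matrix F(a,b) = [u_a w_1 ~ u_b w_2]. It is
   a partial isometry, and the degree condition says exactly that it is normal,
   so F = sum_r d_r u_r u_r' with u_r orthonormal and d_r |d_r|^2 = d_r. These
   edges then contribute sum_r u_r u_r' (x) b_r b_r', b_r = (d_r, - |d_r|^2). *)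

Require Import Defs.
From mathcomp Require Import all_boot all_order all_algebra.
From mathcomp Require Import complex mxtens.
From mathcomp Require Import reals ring.

Set Implicit Arguments.
Unset Strict Implicit.
Unset Printing Implicit Defensive.

Import Order.TTheory GRing.Theory Num.Theory.
Local Open Scope ring_scope.

(** * Adjoints and positive semidefinite matrices *)

Section Hermitian.
Variable C : numClosedFieldType.

Lemma adjointE m n (A : 'M[C]_(m, n)) i j : adjoint A i j = (A j i)^*.
Proof. by rewrite !mxE. Qed.

Lemma adjointK m n (A : 'M[C]_(m, n)) : adjoint (adjoint A) = A.
Proof. by apply/matrixP=> i j; rewrite !adjointE conjCK. Qed.

Lemma adjointM m n p (A : 'M[C]_(m, n)) (B : 'M[C]_(n, p)) :
  adjoint (A *m B) = adjoint B *m adjoint A.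
Proof. by rewrite /adjoint map_mxM trmx_mul. Qed.

Lemma adjointZ m n c (A : 'M[C]_(m, n)) :
  adjoint (c *: A) = c^* *: adjoint A.
Proof. by apply/matrixP=> i j; rewrite !mxE rmorphM. Qed.

Lemma adjointD m n (A B : 'M[C]_(m, n)) :
  adjoint (A + B) = adjoint A + adjoint B.
Proof. by apply/matrixP=> i j; rewrite !mxE rmorphD. Qed.

Lemma adjoint0 m n : adjoint (0 : 'M[C]_(m, n)) = 0.
Proof. by apply/matrixP=> i j; rewrite !mxE rmorph0. Qed.

Lemma adjoint_sum m n I (r : seq I) (F : I -> 'M[C]_(m, n)) :
  adjoint (\sum_(i <- r) F i) = \sum_(i <- r) adjoint (F i).
Proof. by elim/big_rec2: _ => [|i A B _ <-]; rewrite ?adjoint0 ?adjointD. Qed.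

Definition outer n (u : 'cV[C]_n) : 'M[C]_n := u *m adjoint u.

Lemma outerE n (u : 'cV[C]_n) i j : outer u i j = u i 0 * (u j 0)^*.
Proof. by rewrite !mxE big_ord1 adjointE. Qed.

Lemma adjoint_outer n (u : 'cV[C]_n) : adjoint (outer u) = outer u.
Proof. by rewrite /outer adjointM adjointK. Qed.

Lemma psd0 n : psd (0 : 'M[C]_n).
Proof.
by split=> [|v]; [exact: adjoint0 | rewrite mulmx0 mul0mx mxE].
Qed.

Lemma psdD n (A B : 'M[C]_n) : psd A -> psd B -> psd (A + B).
Proof.
move=> [hA pA] [hB pB]; split=> [|v].
  by rewrite /Defs.hermitian adjointD hA hB.
by rewrite mulmxDr mulmxDl mxE addr_ge0.
Qed.

Lemma psdZ n c (A : 'M[C]_n) : 0 <= c -> psd A -> psd (c *: A).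
Proof.
move=> c0 [hA pA]; split=> [|v].
  by rewrite /Defs.hermitian adjointZ hA (CrealP (ger0_real c0)).
by rewrite -scalemxAr -scalemxAl mxE mulr_ge0.
Qed.

Lemma psd_sum n (I : finType) (F : I -> 'M[C]_n) :
  (forall i, psd (F i)) -> psd (\sum_i F i).
Proof. by move=> h; elim/big_ind: _ => //; [exact: psd0 | exact: psdD]. Qed.

Lemma psd_outer n (u : 'cV[C]_n) : psd (outer u).
Proof.
split=> [|v]; first exact: adjoint_outer.
rewrite /outer mulmxA -mulmxA -[adjoint v *m u]adjointK adjointM adjointK.
by rewrite mxE big_ord1 adjointE mulrC mul_conjC_ge0.
Qed.

(** A 1x1 matrix equals its transpose, so the form of [A^T] at [v] is the form of [A] at the
    conjugate of [v]. *)
Lemma psd_tr n (A : 'M[C]_n) : psd A -> psd A^T.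
Proof.
move=> [hA pA]; split=> [|v].
  by rewrite /Defs.hermitian -{2}hA; apply/matrixP=> i j; rewrite !mxE.
suff -> : (adjoint v *m A^T *m v) 0 0
    = (adjoint (map_mx Num.conj v) *m A *m map_mx Num.conj v) 0 0 by [].
transitivity ((adjoint v *m A^T *m v)^T 0 0); first by rewrite [RHS]mxE.
rewrite !trmx_mul trmxK mulmxA.
congr ((_ *m _ *m _) 0 0); apply/matrixP=> i j; rewrite !mxE //.
by rewrite conjCK.
Qed.

(** * Spectral decomposition into rank-one projections *)

Definition orthonormal n (u : 'I_n -> 'cV[C]_n) :=
  forall r s, adjoint (u r) *m u s = (r == s)%:R%:M.

Lemma mul_outer_orthonormal n (u : 'I_n -> 'cV[C]_n) r s : orthonormal u ->
  outer (u r) *m outer (u s) = (r == s)%:R *: outer (u r).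
Proof.
move=> ou; rewrite /outer mulmxA -(mulmxA (u r)) ou.
case: eqP => [->|_]; first by rewrite mulmx1 scale1r.
by rewrite scale0r raddf0 mulmx0 mul0mx.
Qed.

Lemma mul_spectral_sum n (u : 'I_n -> 'cV[C]_n) a b : orthonormal u ->
  (\sum_r a r *: outer (u r)) *m (\sum_r b r *: outer (u r)) =
  \sum_r (a r * b r) *: outer (u r).
Proof.
move=> ou; rewrite mulmx_suml; apply: eq_bigr => r _.
rewrite mulmx_sumr (bigD1 r) //= big1 => [|s /negPf srN].
  rewrite addr0 -scalemxAl -scalemxAr mul_outer_orthonormal // eqxx scale1r.
  by rewrite scalerA.
rewrite -scalemxAl -scalemxAr mul_outer_orthonormal // eq_sym srN.
by rewrite scale0r !scaler0.
Qed.

(** Reads an eigenvalue off as a value of the quadratic form, so that positivity and matrix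
    identities pass to the coefficients. *)
Lemma spectral_sum_coef n (u : 'I_n -> 'cV[C]_n) a r : orthonormal u ->
  (adjoint (u r) *m (\sum_s a s *: outer (u s)) *m u r) 0 0 = a r.
Proof.
move=> ou; rewrite mulmx_sumr (bigD1 r) //= big1 => [|s /negPf srN].
  rewrite addr0 -scalemxAr -scalemxAl /outer mulmxA ou eqxx mul1mx ou eqxx.
  by rewrite !mxE eqxx mulr1.
by rewrite -scalemxAr /outer mulmxA ou eq_sym srN raddf0 mul0mx scaler0.
Qed.

Lemma spectral_sum n (A : 'M[C]_n) : A *m adjoint A = adjoint A *m A ->
  exists u d, orthonormal u /\ A = \sum_(r < n) d r *: outer (u r).
Proof.
move=> nA; have /orthomx_spectralP : A \is normalmx.
  apply/normalmxP; suff <- : adjoint A = map_mx Num.conj A^T by [].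
  by rewrite -map_trmx.
set P := spectralmx A; set d := spectral_diag A.
have PU : P \is unitarymx by apply: spectral_unitarymx.
rewrite invmx_unitary // => A_eq.
(* Since [A] is P' D P with P unitary, the eigenvectors are the columns of P', the adjoints of the
   rows of P. *)
exists (fun r => adjoint (row r P)), (fun r => d 0 r); split=> [r s|].
  move/unitarymxP: PU => /matrixP /(_ r s).
  rewrite adjointK !mxE => PPt; apply/matrixP=> i j.
  rewrite !ord1 !mxE eqxx mulr1n -PPt.
  by apply: eq_bigr => t _; rewrite !mxE.
apply/matrixP=> a b; rewrite {1}A_eq mul_mx_diag !mxE summxE.
apply: eq_bigr => r _; rewrite !mxE big_ord1 !mxE conjCK.
by rewrite mulrAC mulrC mulrA.
Qed.

Lemma psd_spectral_sum n (A : 'M[C]_n) : psd A ->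
  exists (u : 'I_n -> 'cV[C]_n) d,
    (forall r, 0 <= d r) /\ A = \sum_r d r *: outer (u r).
Proof.
move=> [hA pA]; have [|u [d [ou dA]]] := @spectral_sum _ A.
  by rewrite hA.
exists u, d; split=> // r; have := pA (u r).
by rewrite dA spectral_sum_coef.
Qed.

(** * Tensor products, partial transposition and the Peres criterion *)

Lemma tensmx_suml m n p q I (r : seq I) (F : I -> 'M[C]_(m, n))
    (B : 'M[C]_(p, q)) :
  tensmx (\sum_(i <- r) F i) B = \sum_(i <- r) tensmx (F i) B.
Proof.
apply/matrixP=> a b; rewrite !mxE !summxE mulr_suml.
by apply: eq_bigr => i _; rewrite mxE.
Qed.

Lemma tensmx_sumr m n p q I (r : seq I) (A : 'M[C]_(m, n))
    (F : I -> 'M[C]_(p, q)) :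
  tensmx A (\sum_(i <- r) F i) = \sum_(i <- r) tensmx A (F i).
Proof.
apply/matrixP=> a b; rewrite !mxE !summxE mulr_sumr.
by apply: eq_bigr => i _; rewrite mxE.
Qed.

Lemma tensmxZ m n p q a b (A : 'M[C]_(m, n)) (B : 'M[C]_(p, q)) :
  tensmx (a *: A) (b *: B) = (a * b) *: tensmx A B.
Proof. by apply/matrixP=> i j; rewrite !mxE mulrACA. Qed.

Lemma tensmx_outer m n (u : 'cV[C]_m) (v : 'cV[C]_n) :
  tensmx (outer u) (outer v) = outer (tensmx u v : 'cV[C]_(m * n)).
Proof.
apply/matrixP=> i j; rewrite outerE mxE !outerE !mxE rmorphM mulrACA.
by congr (u _ _ * v _ _ * ((u _ _)^* * (v _ _)^*)); rewrite ord1.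
Qed.

(** Both factors are nonnegative sums of rank-one terms, and a tensor product of two such terms is
    again of the form w w'. *)
Lemma psd_tens m n (A : 'M[C]_m) (B : 'M[C]_n) :
  psd A -> psd B -> psd (tensmx A B).
Proof.
move=> /psd_spectral_sum[u [a [a0 ->]]] /psd_spectral_sum[v [b [b0 ->]]].
rewrite tensmx_suml; apply: psd_sum => r.
rewrite tensmx_sumr; apply: psd_sum => s.
rewrite tensmxZ tensmx_outer; apply: psdZ; last exact: psd_outer.
exact: mulr_ge0.
Qed.

Definition ptrans_mx m n (X : 'M[C]_(m * n)) : 'M[C]_(m * n) :=
  \matrix_(a, b) X
    (mxtens_index ((mxtens_unindex a).1, (mxtens_unindex b).2))
    (mxtens_index ((mxtens_unindex b).1, (mxtens_unindex a).2)).

Lemma ptrans_tens m n (A : 'M[C]_m) (B : 'M[C]_n) :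
  ptrans_mx (tensmx A B) = tensmx A B^T.
Proof. by apply/matrixP=> a b; rewrite !mxE !mxtens_indexK. Qed.

(** Partial transposition is linear and replaces each [B l] by its transpose, which stays positive
    semidefinite. *)
Lemma separable_ppt m n (X : 'M[C]_(m * n)) : separable X -> psd (ptrans_mx X).
Proof.
move=> [N [p [A [B [p0 _ dA dB ->]]]]].
have -> : ptrans_mx (\sum_l p l *: tensmx (A l) (B l))
        = \sum_l p l *: ptrans_mx (tensmx (A l) (B l)).
  apply/matrixP=> a b; rewrite mxE !summxE.
  by apply: eq_bigr => l _; rewrite !mxE.
apply: psd_sum => l; apply: psdZ => //; rewrite ptrans_tens.
by apply: psd_tens; [case: (dA l) | apply: psd_tr; case: (dB l)].
Qed.

(** * The cone generated by product states *)

(* Separable states up to normalization; the weights need not sum to 1, since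
   the trace of the whole matrix fixes their sum. *)
Inductive sepcone m n : 'M[C]_(m * n) -> Prop :=
| sepcone0 : sepcone 0
| sepcone_cons p A B X of 0 <= p & density A & density B & sepcone X :
    sepcone (p *: tensmx A B + X).

Lemma sepconeD m n (X Y : 'M[C]_(m * n)) :
  sepcone X -> sepcone Y -> sepcone (X + Y).
Proof.
elim=> [|p A B Z p0 dA dB _ ih] hY; first by rewrite add0r.
by rewrite -addrA; apply: sepcone_cons => //; apply: ih.
Qed.

Lemma sepconeZ m n c (X : 'M[C]_(m * n)) :
  0 <= c -> sepcone X -> sepcone (c *: X).
Proof.
move=> c0; elim=> [|p A B Z p0 dA dB _ ih]; first by rewrite scaler0; left.
by rewrite scalerDr scalerA; apply: sepcone_cons => //; apply: mulr_ge0.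
Qed.

Lemma sepcone_sum m n (I : finType) (F : I -> 'M[C]_(m * n)) :
  (forall i, sepcone (F i)) -> sepcone (\sum_i F i).
Proof.
by move=> h; elim/big_ind: _ => //; [exact: sepcone0 | exact: sepconeD].
Qed.

Lemma tr_outer_ge0 n (u : 'cV[C]_n) : 0 <= \tr (outer u).
Proof. by apply: sumr_ge0 => i _; rewrite outerE mul_conjC_ge0. Qed.

Lemma tr_outer_eq0 n (u : 'cV[C]_n) : \tr (outer u) = 0 -> u = 0.
Proof.
move=> tr0; apply/matrixP=> i j; rewrite ord1 mxE; apply/eqP.
rewrite -mul_conjC_eq0 -outerE; apply/eqP.
by apply: (psumr_eq0P _ tr0) => // l _; rewrite outerE mul_conjC_ge0.
Qed.

Lemma density_outer n (u : 'cV[C]_n) : u != 0 ->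
  density ((\tr (outer u))^-1 *: outer u).
Proof.
move=> u0; split; first apply: psdZ; rewrite ?invr_ge0 ?tr_outer_ge0 //.
  exact: psd_outer.
rewrite mxtraceZ mulVf //; apply: contra_neq u0; exact: tr_outer_eq0.
Qed.

(** Dividing each factor by its trace gives densities, and the product of the traces becomes the
    weight. A zero vector cannot be normalized and is treated apart. *)
Lemma sepcone_outer m n (u : 'cV[C]_m) (v : 'cV[C]_n) :
  sepcone (tensmx (outer u) (outer v)).
Proof.
have [->|u0] := eqVneq u 0.
  by rewrite /outer mul0mx tens0mx; apply: sepcone0.
have [->|v0] := eqVneq v 0.
  by rewrite /outer mul0mx tensmx0; apply: sepcone0.
have tu0 : \tr (outer u) != 0 by apply: contra_neq u0; apply: tr_outer_eq0.
have tv0 : \tr (outer v) != 0 by apply: contra_neq v0; apply: tr_outer_eq0.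
have := sepcone_cons (mulr_ge0 (tr_outer_ge0 u) (tr_outer_ge0 v))
  (density_outer u0) (density_outer v0) (sepcone0 m n).
by rewrite addr0 -tensmxZ !scalerA !mulfV // !scale1r.
Qed.

Lemma tr_tensmx m n (A : 'M[C]_m) (B : 'M[C]_n) :
  \tr (tensmx A B) = \tr A * \tr B.
Proof. by rewrite mulr_sum; apply: eq_bigr => i _; rewrite mxE. Qed.

Lemma sepcone_separable m n (X : 'M[C]_(m * n)) :
  sepcone X -> \tr X = 1 -> separable X.
Proof.
move=> cX trX; suff [N [p [A [B [p0 dA dB XE]]]]] : exists N p A B,
    [/\ forall l : 'I_N, 0 <= p l, forall l : 'I_N, density (A l),
      forall l : 'I_N, density (B l) & X = \sum_l p l *: tensmx (A l) (B l)].
  exists N, p, A, B; split=> //; rewrite -trX XE raddf_sum.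
  apply: eq_bigr => l _ /=; rewrite mxtraceZ tr_tensmx.
  by case: (dA l) (dB l) => _ -> [_ ->]; rewrite !mulr1.
elim: cX => {X trX} [|p A B X p0 dA dB _ [N [ps [As [Bs [ps0 dAs dBs ->]]]]]].
  exists 0%N, (fun=> 0), (fun=> 0), (fun=> 0); split; try by case.
  by rewrite big_ord0.
pose cons T (x : T) xs (l : 'I_N.+1) :=
  if unlift ord0 l is Some l' then xs l' else x.
exists N.+1, (cons _ p ps), (cons _ A As), (cons _ B Bs).
split; try by move=> l; rewrite /cons; case: unlift.
rewrite big_ord_recl /cons unlift_none; congr (_ + _).
by apply: eq_bigr => l _; rewrite liftK.
Qed.

End Hermitian.

(** * Normal partial isometries and weighted Laplacians *)

Section PartialIsometry.
Variable C : numClosedFieldType.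

Lemma adjoint_spectral_sum n (u : 'I_n -> 'cV[C]_n) a :
  adjoint (\sum_r a r *: outer (u r)) = \sum_r (a r)^* *: outer (u r).
Proof.
by rewrite adjoint_sum; apply: eq_bigr => r _; rewrite adjointZ adjoint_outer.
Qed.

Lemma normal_partial_isometry_spectral n (F : 'M[C]_n) :
  F *m adjoint F = adjoint F *m F -> F *m adjoint F *m F = F ->
  exists (u : 'I_n -> 'cV[C]_n) d,
    [/\ F = \sum_r d r *: outer (u r),
        F *m adjoint F = \sum_r (d r * (d r)^*) *: outer (u r) &
        forall r, d r * (d r)^* * d r = d r].
Proof.
move=> nF iF; have [u [d [ou FE]]] := spectral_sum nF.
have FFE : F *m adjoint F = \sum_r (d r * (d r)^*) *: outer (u r).
  by rewrite FE adjoint_spectral_sum mul_spectral_sum.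
exists u, d; split=> // r.
(* Comparing the coefficients of F F' F and F at [u r] shows that each eigenvalue is zero or of
   modulus one. *)
rewrite -[RHS](spectral_sum_coef d r ou) -FE -iF FFE FE mul_spectral_sum //.
by rewrite spectral_sum_coef.
Qed.

(** The Laplacian is a sum of edge terms. The factor 1/2 compensates for ordered pairs meeting each
    edge twice; terms with i = j vanish on the left and cancel on the right. *)
Lemma laplacian_outer n (h : 'I_n -> 'I_n -> C) : (forall i j, h i j = h j i) ->
  \sum_i \sum_j (h i j / 2) *: outer (delta_mx i 0 - delta_mx j 0 : 'cV[C]_n) =
  \matrix_(a, b) ((a == b)%:R * (\sum_c h a c) - h a b).
Proof.
move=> hC; apply/matrixP=> a b; rewrite mxE summxE.
have entry i j :
   ((h i j / 2) *: outer (delta_mx i 0 - delta_mx j 0 : 'cV[C]_n)) a b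
   = (a == i)%:R * ((b == i)%:R * (h i j / 2))
   + (a == j)%:R * ((b == j)%:R * (h i j / 2))
   - (a == i)%:R * ((b == j)%:R * (h i j / 2))
   - (a == j)%:R * ((b == i)%:R * (h i j / 2)).
  by rewrite mxE outerE !mxE !andbT rmorphB !rmorph_nat; ring.
have pick (f : 'I_n -> C) c : \sum_i (c == i)%:R * f i = f c.
  rewrite (bigD1 c) //= eqxx mul1r big1 ?addr0 // => i /negPf ic.
  by rewrite eq_sym ic mul0r.
under eq_bigr do (rewrite summxE; under eq_bigr do rewrite entry).
under eq_bigr do rewrite !sumrB big_split /= -!mulr_sumr !pick.
rewrite !sumrB big_split /= !pick -!mulr_sumr (hC b a).
rewrite -!mulr_suml (_ : \sum_i h i a = \sum_c h a c); last exact: eq_bigr.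
by rewrite (eq_sym b); field.
Qed.

End PartialIsometry.

(** * Degrees and edge counts *)

Section Graph.
Variables (C : numClosedFieldType) (k : nat).
Implicit Types (e : rel (vert k)) (v w : vert k).

Lemma sum_I2 (V : nmodType) (f : 'I_2 -> V) : \sum_x f x = f 0 + f 1.
Proof.
by rewrite big_ord_recl big_ord1; congr (_ + f _); apply: val_inj.
Qed.

Lemma I2P (x : 'I_2) : x = 0 \/ x = 1.
Proof. by case: x => [[|[|//]] px]; [left|right]; apply: val_inj. Qed.

Lemma degE e v : deg e v = (\sum_w e v w)%N.
Proof.
rewrite /deg -sum1dep_card big_mkcond; apply: eq_bigr => w _.
by case: (e v w).
Qed.

Lemma deg_split e v :
  (deg e v)%:R = \sum_c (e v (c, 0))%:R + \sum_c (e v (c, 1))%:R :> C.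
Proof.
rewrite degE natr_sum -big_split /=.
rewrite (eq_bigr (fun w => (e v (w.1, w.2))%:R)); last by case.
rewrite -(pair_bigA _ (fun c x => (e v (c, x))%:R)) /=.
by apply: eq_bigr => c _; rewrite sum_I2.
Qed.

Lemma twice_nedgesE e : twice_nedges e = (\sum_v deg e v)%N.
Proof.
rewrite /twice_nedges -sum1dep_card big_mkcond.
rewrite -(pair_bigA _ (fun v w => if e v w then 1%N else 0%N)) /=.
by apply: eq_bigr => v _; rewrite degE; apply: eq_bigr => w _; case: (e v w).
Qed.

(** Exchanging the second coordinates of an ordered pair is an involution that carries one edge set
    onto the other. *)
Lemma twice_nedges_ptransB e : twice_nedges (ptransB e) = twice_nedges e.
Proof.
pose f (p : vert k * vert k) := ((p.1.1, p.2.2), (p.2.1, p.1.2)).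
have fK : involutive f by case=> [[a x] [b y]].
rewrite /twice_nedges -(card_imset _ (inv_inj fK)); apply: eq_card => p.
by rewrite -[p]fK mem_imset ?inE //; exact: inv_inj.
Qed.

Lemma ptransB_sym e : symmetric e -> symmetric (ptransB e).
Proof. by move=> eC v w; rewrite /ptransB eC. Qed.

Lemma degmx_eq e e' :
  degmx C e = degmx C e' <-> forall v, deg e v = deg e' v.
Proof.
split=> [/matrixP E v|E]; last first.
  by apply/matrixP=> a b; rewrite !mxE E.
have /eqP := E (mxtens_index v) (mxtens_index v).
by rewrite !mxE eqxx mxtens_indexK eqr_nat => /eqP.
Qed.

Lemma sum_mxtens (f : vert k -> C) :
  \sum_(a < k * 2) f (mxtens_unindex a) = \sum_v f v.
Proof.
rewrite [RHS](reindex (@mxtens_unindex k 2)) //=.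
by exists (@mxtens_index k 2) => a _; rewrite (mxtens_indexK, mxtens_unindexK).
Qed.

(** * Perfect matchings: both implications *)

Section Matching.

Variable e : rel (vert k).
Hypotheses (eC : symmetric e) (eI : irreflexive e).
Hypothesis (deg1 : forall v, deg e v = 1%N).

Lemma twice_nedges_matching : twice_nedges e = (k * 2)%N.
Proof.
rewrite twice_nedgesE (eq_bigr (fun=> 1%N)) => [|v _]; last exact: deg1.
by rewrite sum1_card card_prod !card_ord.
Qed.

Lemma lapmx_matching : lapmx C e = 1%:M - adjmx C e.
Proof.
by congr (_ - _); apply/matrixP=> a b; rewrite !mxE deg1; case: (a == b).
Qed.

(** The degree matrix of a matching is the identity, which partial transposition fixes; only the
    adjacency part changes. *)
Lemma ptrans_rho_matching :
  ptrans_mx (rho C e) =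
  (twice_nedges e)%:R^-1 *: (1%:M - adjmx C (ptransB e)).
Proof.
rewrite /rho lapmx_matching; apply/matrixP=> a b; rewrite !mxE !mxtens_indexK.
congr (_ * (_%:R - _)); rewrite (can_eq (@mxtens_indexK _ _)).
rewrite -(can_eq (@mxtens_unindexK _ _)).
case: (mxtens_unindex a) (mxtens_unindex b) => [i x] [j y].
by rewrite !xpair_eqE [y == x]eq_sym.
Qed.

Lemma matching_inj v v' w : e v w -> e v' w -> v = v'.
Proof.
move=> vw v'w; have /eqP/cards1P[z E] := deg1 w.
have: v \in [set z] by rewrite -E inE eC.
have: v' \in [set z] by rewrite -E inE eC.
by rewrite !inE => /eqP-> /eqP->.
Qed.

Lemma psd_deg_ptransB :
  psd (1%:M - adjmx C (ptransB e)) -> forall v, deg (ptransB e) v = 1%N.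
Proof.
set N := 1%:M - _ => psdN v; pose c := mxtens_index v.
have [g gE] : exists g : 'I_(k * 2) -> C,
    forall a, g a = 1 - (deg (ptransB e) (mxtens_unindex a))%:R by eexists.
have rowN a : \sum_b N a b = g a.
  rewrite gE degE natr_sum -sum_mxtens.
  under eq_bigr do rewrite !mxE.
  rewrite sumrB; congr (_ - _).
  by rewrite (bigD1 a) //= eqxx big1 ?addr0 // => b; rewrite eq_sym => /negPf->.
have symN a b : N a b = N b a by rewrite !mxE eq_sym ptransB_sym.
have Ncc : N c c = 1 by rewrite !mxE eqxx /ptransB eI subr0.
(* Both graphs have 2k ordered edges on 2k vertices, so the degree defects cancel. *)
have sum_g : \sum_a g a = 0.
  rewrite (eq_bigr _ (fun a _ => gE a)) sumrB.
  rewrite (sum_mxtens (fun v => (deg (ptransB e) v)%:R)) -natr_sum.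
  rewrite -twice_nedgesE twice_nedges_ptransB twice_nedges_matching.
  by rewrite sumr_const card_ord subrr.
have gR a : (g a)^* = g a by rewrite gE rmorphB rmorph1 rmorph_nat.
(* At 1 + t e_c the form equals 2 t g(c) + t^2, which is minimal at this [t]. *)
pose t := - g c; have tR : t^* = t by rewrite /t rmorphN /= gR.
pose x : 'cV[C]_(k * 2) := \col_a (1 + (a == c)%:R * t).
have Nx a : (N *m x) a 0 = g a + t * N a c.
  rewrite mxE; under eq_bigr do rewrite [x _ _]mxE mulrDr mulr1.
  rewrite big_split /= rowN; congr (_ + _).
  rewrite (bigD1 c) //= eqxx mul1r big1 ?addr0 1?mulrC // => b /negPf->.
  by rewrite mul0r mulr0.
have : 0 <= - (g c ^+ 2).
  suff -> : - g c ^+ 2 = (adjoint x *m N *m x) 0 0 by case: psdN.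
  rewrite -mulmxA mxE.
  under eq_bigr => a _.
    rewrite Nx adjointE [x _ _]mxE rmorphD rmorph1 rmorphM rmorph_nat /= tR.
    rewrite mulrDl mul1r.
    over.
  rewrite !big_split /= sum_g add0r -mulr_sumr.
  rewrite (eq_bigr (fun a => N c a)) => [|a _]; last exact: symN.
  rewrite rowN (bigD1 c) //= eqxx big1 => [|b /negPf->]; last by rewrite !mul0r.
  by rewrite Ncc /t; ring.
rewrite oppr_ge0 => g2; have : g c ^+ 2 = 0.
  apply/eqP; rewrite eq_le g2 real_exprn_even_ge0 //.
  exact/CrealP.
move/eqP; rewrite sqrf_eq0 gE subr_eq0 eq_sym /c mxtens_indexK.
rewrite -[1]/(1%:R) eqr_nat.
by move/eqP.
Qed.

Lemma separable_deg_ptransB : (0 < k)%N -> separable (rho C e) ->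
  forall v, deg (ptransB e) v = 1%N.
Proof.
move=> k0 /separable_ppt; rewrite ptrans_rho_matching => psdX.
apply: psd_deg_ptransB.
(* Positivity of [k] makes the normalizing factor invertible, so it can be cleared. *)
have tn0 : (twice_nedges e)%:R != 0 :> C.
  by rewrite twice_nedges_matching pnatr_eq0 -lt0n muln_gt0 k0.
by have := psdZ (ler0n C (twice_nedges e)) psdX; rewrite scalerA mulfV ?scale1r.
Qed.

Lemma tr_rho_matching : (0 < k)%N -> \tr (rho C e) = 1.
Proof.
move=> k0; rewrite /rho lapmx_matching mxtraceZ raddfB /= mxtrace1.
rewrite [\tr (adjmx _ _)]big1 => [|a _]; last by rewrite mxE eI.
by rewrite subr0 twice_nedges_matching mulVf // pnatr_eq0 -lt0n muln_gt0 k0.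
Qed.

Lemma sepcone_lapmx :
  (forall v, deg (ptransB e) v = 1%N) -> sepcone (lapmx C e).
Proof.
move=> deg'1.
pose E v w : C := (e v w)%:R.
pose s a := \sum_c E (a, 0) (c, 1).
have E_conj v w : (E v w)^* = E v w by rewrite rmorph_nat.
have E_sym v w : E v w = E w v by rewrite /E eC.
have row0 a : \sum_c E (a, 0) (c, 0) + s a = 1 by rewrite -deg_split deg1.
have col0 a : \sum_c E (a, 1) (c, 0) + \sum_c E (a, 1) (c, 1) = 1.
  by rewrite -deg_split deg1.
(* In the partial transpose, (a, 1) is adjacent to (c, 0) exactly when (a, 0) is adjacent to (c, 1)
   in [e], hence the term [s a]. *)
have row1 a : s a + \sum_c E (a, 1) (c, 1) = 1.
  by have := deg_split (ptransB e) (a, 1); rewrite deg'1 => /esym.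
(* Row and column sums of the cross-edge matrix agree: this is where the degree condition yields
   normality. *)
have col1 a : \sum_c E (c, 0) (a, 1) = s a.
  under eq_bigr do rewrite E_sym.
  by apply: (addIr (\sum_c E (a, 1) (c, 1))); rewrite col0 row1.
(* Distinct vertices share no neighbour, so distinct rows have disjoint supports; this makes both F
   F' and F' F diagonal. *)
have EE v v' w : E v w * E v' w = (v == v')%:R * E v w.
  rewrite /E; case vw: (e v w); last by rewrite mul0r mulr0.
  rewrite mul1r mulr1; case: eqP => [<-|vv']; first by rewrite vw.
  by case v'w: (e v' w) => //; case: vv'; apply: matching_inj vw v'w.
pose F : 'M[C]_k := \matrix_(a, b) E (a, 0) (b, 1).
have FF : F *m adjoint F = \matrix_(a, b) ((a == b)%:R * s a).
  apply/matrixP=> a b; rewrite !mxE mulr_sumr; apply: eq_bigr => c _.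
  by rewrite adjointE !mxE E_conj EE xpair_eqE eqxx andbT.
have FF' : adjoint F *m F = \matrix_(a, b) ((a == b)%:R * s a).
  apply/matrixP=> a b; rewrite !mxE -col1 mulr_sumr; apply: eq_bigr => c _.
  rewrite adjointE !mxE E_conj !(E_sym (c, 0)) EE.
  by rewrite xpair_eqE eqxx andbT.
(* F F' is diagonal with entries [s a], and [s a] is 1 on every nonzero row of [F]. *)
have FFF : F *m adjoint F *m F = F.
  rewrite FF; apply/matrixP=> a b; rewrite !mxE (bigD1 a) //= big1.
    rewrite !mxE eqxx mul1r addr0 /s mulr_suml (bigD1 b) //= big1.
      by rewrite addr0 ![E _ (b, 1)]E_sym EE eqxx mul1r.
    move=> c /negPf cb; rewrite ![E (a, 0) _]E_sym EE.
    by rewrite xpair_eqE cb mul0r.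
  by move=> c /negPf ca; rewrite !mxE eq_sym ca !mul0r.
have [u [d [FE FFE dE]]] :=
  normal_partial_isometry_spectral (etrans FF (esym FF')) FFF.
pose H x := \sum_i \sum_j (E (i, x) (j, x) / 2) *:
  outer (delta_mx i 0 - delta_mx j 0 : 'cV[C]_k).
(* As d |d|^2 = d, the entries of b b' are |d|^2, -d, -d', |d|^2. Weighted by [outer (u r)] they sum
   to the blocks F F', -F, -F', F F'. *)
pose b r : 'cV[C]_2 := \col_x (if x == 0 then d r else - (d r * (d r)^*)).
suff -> : lapmx C e = \sum_x tensmx (H x) (outer (delta_mx x 0))
                    + \sum_r tensmx (outer (u r)) (outer (b r)).
  apply: sepconeD; apply: sepcone_sum => x; last exact: sepcone_outer.
  rewrite tensmx_suml; apply: sepcone_sum => i.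
  rewrite tensmx_suml; apply: sepcone_sum => j.
  rewrite -[outer (delta_mx x 0)]scale1r tensmxZ mulr1.
  apply: sepconeZ; last exact: sepcone_outer.
  by rewrite divr_ge0 ?ler0n.
have HE x := laplacian_outer (fun i j => E_sym (i, x) (j, x)).
have FEab i j : \sum_r outer (u r) i j * d r = E (i, 0) (j, 1).
  have /matrixP/(_ i j) := FE; rewrite mxE => ->; rewrite summxE.
  by apply: eq_bigr => r _; rewrite [RHS]mxE mulrC.
have FE'ab i j : \sum_r outer (u r) i j * (d r)^* = E (j, 0) (i, 1).
  have /matrixP/(_ i j) := congr1 (@adjoint _ _ _) FE.
  rewrite adjoint_spectral_sum adjointE mxE E_conj => ->; rewrite summxE.
  by apply: eq_bigr => r _; rewrite [RHS]mxE mulrC.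
have FFEab i j : \sum_r outer (u r) i j * (d r * (d r)^*) = (i == j)%:R * s i.
  have /matrixP/(_ i j) := FFE; rewrite FF mxE => ->; rewrite summxE.
  by apply: eq_bigr => r _; rewrite [RHS]mxE mulrC.
have dE' r : d r * (d r)^* * (d r)^* = (d r)^*.
  by rewrite -[in RHS](dE r) !rmorphM /= conjCK [(d r)^* * d r]mulrC.
have b00 i j : \sum_r outer (u r) i j * outer (b r) 0 0 = (i == j)%:R * s i.
  by rewrite -FFEab; apply: eq_bigr => r _; congr (_ * _); rewrite outerE !mxE.
have b01 i j : \sum_r outer (u r) i j * outer (b r) 0 1 = - E (i, 0) (j, 1).
  rewrite -FEab -sumrN; apply: eq_bigr => r _; rewrite -mulrN; congr (_ * _).
  by rewrite outerE !mxE /= rmorphN rmorphM /= conjCK mulrN mulrA dE.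
have b10 i j : \sum_r outer (u r) i j * outer (b r) 1 0 = - E (j, 0) (i, 1).
  rewrite -FE'ab -sumrN; apply: eq_bigr => r _; rewrite -mulrN; congr (_ * _).
  by rewrite outerE !mxE /= mulNr dE'.
have b11 i j : \sum_r outer (u r) i j * outer (b r) 1 1 = (i == j)%:R * s i.
  rewrite -FFEab; apply: eq_bigr => r _; congr (_ * _).
  by rewrite outerE !mxE /= rmorphN rmorphM /= conjCK mulrNN mulrA dE' mulrC.
rewrite lapmx_matching; apply/matrixP=> p q.
case: (mxtens_indexP p) => i x; case: (mxtens_indexP q) => j y.
rewrite [RHS]mxE !summxE; under eq_bigr do rewrite tensmxE.
under [X in _ = _ + X]eq_bigr do rewrite tensmxE.
rewrite sum_I2 /H !HE !outerE !mxE !mxtens_indexK (can_eq (@mxtens_indexK _ _)).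
rewrite xpair_eqE -/(E _ _).
(* Blockwise comparison: on the diagonal, the degree inside the column plus [s i] is 1 by [row0] or
   [row1]; the other two blocks are the negated cross edges. *)
have [->|->] := I2P x; have [->|->] := I2P y;
  rewrite ?andbT ?andbF /= ?rmorph_nat.
- rewrite b00 -[X in X - _ = _]mulr1 -[X in _ * X - _ = _](row0 i); ring.
- rewrite b01; ring.
- rewrite b10 [E (j, 0) _]E_sym; ring.
- rewrite b11 -[X in X - _ = _]mulr1 -[X in _ * X - _ = _](row1 i); ring.
Qed.

End Matching.

End Graph.

Theorem theorem4 (R : realType) (k : nat) (e : rel (vert k)) :
  (0 < k)%N -> perfect_matching e ->
  (separable (rho R[i] e) <-> degmx R[i] e = degmx R[i] (ptransB e)).
Proof.
move=> k0 [[eC eI] deg1]; split=> [sep|/degmx_eq deg_eq].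
  apply/degmx_eq => v.
  by rewrite (separable_deg_ptransB eC eI deg1 k0 sep) deg1.
apply: sepcone_separable; last exact: tr_rho_matching.
apply: sepconeZ; first by rewrite invr_ge0 ler0n.
by apply: sepcone_lapmx => // v; rewrite -deg_eq.
Qed.
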